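(* Let $H$ be an ordered graph and $\eta>0$. Then there exists an integer $n_0=n_0(H,\eta)$ such that if $n\geq n_0$ then \begin{itemize} \item[(i)] if $H$ has no local barrier, $\left(1-\frac{1}{\chi_<(H)-1}\right)n<\delta_{\mathrm{cov}}(H,n)\leq\left(1-\frac{1}{\chi_<(H)-1}+\eta\right)n$; \item[(ii)] if $H$ has a local barrier, $\left(1-\frac{1}{\chi_<(H)}\right)n<\delta_{\mathrm{cov}}(H,n)\leq\left(1-\frac{1}{\chi_<(H)}+\eta\right)n$. \end{itemize}
   Context: An ordered graph on $h$ vertices is a graph with vertex set $[h]$ (ordered naturally). An ordered graph $G$ on $[n]$ contains an ordered graph $H$ on $[h]$ if there is an injection $\phi:[h]\to[n]$ with $\phi(i)<\phi(j)$ for $i<j$ and $\phi(i)\phi(j)\in E(G)$ whenever $ij\in E(H)$; the image is a copy of $H$. For sets $X,Y$ of integers, $X<Y$ means $x<y$ for all $x\in X,y\in Y$. An interval $r$-colouring of $H$ is a partition of $[h]$ into $r$ intervals $V_1<\dots<V_r$ (some possibly empty) with no edge of $H$ inside any interval; $\chi_<(H)$ is the least such $r$. $G$ has an $H$-cover if every vertex of $G$ lies in a copy of $H$ in $G$. $\delta_{\mathrm{cov}}(H,n)$ is the smallest integer $k$ such that every $n$-vertex ordered graph $G$ with $\delta(G)\geq k$ contains an $H$-cover. An ordered graph $H$ with $r:=\chi_<(H)\geq 2$ has a local barrier if there exist fixed $i\neq j\in[r+1]$ such that for every interval $(r+1)$-colouring $V_1<\dots<V_{r+1}$ of $H$ in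 which $V_i=\{v\}$ is a singleton, there is at least one edge of $H$ between $v$ and $V_j$. *)

(* Defs.v *)
From mathcomp Require Import all_boot all_order all_algebra.
From mathcomp Require Import boolp reals.

Set Implicit Arguments.
Unset Strict Implicit.
Unset Printing Implicit Defensive.

(* The vertex set [n] is represented by 'I_n = {0, ..., n-1}, so all indices
   (of vertices and of colour classes) are shifted down by one. *)
Record ograph (n : nat) := OGraph {
  adj :> rel 'I_n;
  adj_sym : symmetric adj;
  adj_irr : irreflexive adj }.

Definition is_copy (h n : nat) (H : ograph h) (G : ograph n)
    (phi : 'I_h -> 'I_n) : Prop :=
  [/\ injective phi,
      forall i j : 'I_h, i < j -> phi i < phi j
    & forall i j : 'I_h, H i j -> G (phi i) (phi j)].

Definition has_cover (h n : nat) (H : ograph h) (G : ograph n) : Prop :=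
  forall x : 'I_n, exists phi : 'I_h -> 'I_n,
    is_copy H G phi /\ exists i : 'I_h, phi i = x.

Definition degree (n : nat) (G : ograph n) (x : 'I_n) : nat :=
  #|[set y | G x y]|.

(* Every degree is smaller than n, so the default value n only matters when
   n = 0. *)
Definition min_degree (n : nat) (G : ograph n) : nat :=
  \big[minn/n]_(x < n) degree G x.

Definition set_lt (n : nat) (X Y : {set 'I_n}) : Prop :=
  forall x y : 'I_n, x \in X -> y \in Y -> x < y.

Definition is_interval (n : nat) (X : {set 'I_n}) : Prop :=
  forall x y z : 'I_n, x \in X -> z \in X -> x <= y <= z -> y \in X.

(* Since classes may be empty, V_1 < ... < V_r is required for all pairs of
   classes, not just consecutive ones; this makes them pairwise disjoint. *)
Definition interval_colouring (h : nat) (H : ograph h) (r : nat)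
    (V : 'I_r -> {set 'I_h}) : Prop :=
  [/\ forall x : 'I_h, exists i : 'I_r, x \in V i,
      forall i : 'I_r, is_interval (V i),
      forall i j : 'I_r, i < j -> set_lt (V i) (V j)
    & forall (i : 'I_r) (x y : 'I_h), x \in V i -> y \in V i -> ~~ H x y].

Lemma interval_colouring_ex (h : nat) (H : ograph h) :
  exists r : nat, `[< exists V, @interval_colouring h H r V >].
Proof.
exists h; apply/asboolP; exists (fun i => [set i]); split.
- by move=> x; exists x; rewrite set11.
- move=> i x y z /set1P-> /set1P-> yi; apply/set1P/val_inj.
  by apply/eqP; rewrite /= eqn_leq andbC.
- by move=> i j ij x y /set1P-> /set1P->.
- by move=> i x y /set1P-> /set1P->; rewrite adj_irr.
Qed.

Definition interval_chi (h : nat) (H : ograph h) : nat :=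
  ex_minn (interval_colouring_ex H).

Definition cover_threshold (h : nat) (H : ograph h) (n k : nat) : Prop :=
  forall G : ograph n, k <= min_degree G -> has_cover H G.

Lemma cover_threshold_ex (h : nat) (H : ograph h) (n : nat) :
  exists k : nat, `[< cover_threshold H n k >].
Proof.
exists n; apply/asboolP => G le_n x; exfalso.
have deg_lt : degree G x < n.
  rewrite /degree -[ltnRHS]card_ord -cardsT; apply: proper_card.
  by apply/properP; split; [exact: subsetT | exists x; rewrite ?inE // adj_irr].
have : min_degree G <= degree G x.
  rewrite /min_degree; elim: (index_enum _) (mem_index_enum x) => //= y s IHs.
  rewrite big_cons inE geq_min => /predU1P[<- | /IHs->]; last exact: orbT.
  by rewrite leqnn.
by rewrite leqNgt (leq_trans deg_lt le_n).
Qed.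

Definition delta_cov (h : nat) (H : ograph h) (n : nat) : nat :=
  ex_minn (cover_threshold_ex H n).

(* Only meaningful when interval_chi H >= 2. *)
Definition has_local_barrier (h : nat) (H : ograph h) : Prop :=
  let r := interval_chi H in
  exists i j : 'I_r.+1, i != j /\
    forall V : 'I_r.+1 -> {set 'I_h}, interval_colouring H V ->
    forall v : 'I_h, V i = [set v] -> exists2 w : 'I_h, w \in V j & H v w.

(* Main.v *)
Require Import Defs.
From mathcomp Require Import all_boot all_order all_algebra.
From mathcomp Require Import boolp reals.
From mathcomp Require Import zify ring lra.

Set Implicit Arguments.
Unset Strict Implicit.
Unset Printing Implicit Defensive.

Import Order.TTheory GRing.Theory Num.Theory.

(* Let r be the interval chromatic number of H.
   Upper bounds: fix a vertex x and put m = r - 1 if H has no local barrier,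
   m = r otherwise.  If every vertex misses at most (1 - 1/p) n/m vertices, then
   for k < m every vertex misses at most (1 - 1/p) |N(x)|/k vertices of N(x),
   so the Erdos-Stone induction yields a complete m-partite graph with large
   parts inside N(x).  When m = r - 1, one more induction step, run in the whole
   graph, adds a part that x need not be joined to.  Passing to subsets we may
   assume that {x} and the r parts lie one after another, and H embeds
   through x along an interval (r+1)-colouring in which the class of x is a
   singleton; in the absence of a local barrier this colouring can be chosen
   with no edge between x and the part it may not be joined to.
   Lower bounds: an interval-complete (r-1)-partite graph contains no copy of H.
   Given a local barrier (i, j), take the interval-complete (r+1)-partite graph
   whose i-th part is a singleton and remove the edges between parts i and j;
   that singleton lies in no copy of H. *)

(** * Counting in finite sets *)

Lemma card_range n lo hi : #|[set y : 'I_n | lo <= y < hi]| <= hi - lo.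
Proof.
rewrite cardE -(size_map val) -(size_iota lo (hi - lo)).
apply: uniq_leq_size; first by rewrite map_inj_uniq ?enum_uniq //; exact: val_inj.
by move=> _ /mapP[y + ->]; rewrite mem_enum inE mem_iota /=; lia.
Qed.

Definition subset_of_size (T : finType) t (A : {set T}) : {set T} :=
  [set:: take t (enum A)].

Lemma subset_of_size_sub (T : finType) t (A : {set T}) :
  subset_of_size t A \subset A.
Proof. by apply/subsetP => y; rewrite inE => /mem_take; rewrite mem_enum. Qed.

Lemma card_subset_of_size (T : finType) t (A : {set T}) :
  t <= #|A| -> #|subset_of_size t A| = t.
Proof.
move=> tA; rewrite cardsE; move/card_uniqP: (take_uniq t (enum_uniq A)) => ->.
by rewrite size_takel -?cardE.
Qed.

Lemma pigeonhole (aT rT : finType) (f : aT -> rT) (A : {set aT})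
    (S : {set rT}) t :
  {in A, forall y, f y \in S} -> #|S| * t < #|A| ->
  exists z, t <= #|[set y in A | f y == z]|.
Proof.
move=> fS; apply: contraPP => noz; apply/negP; rewrite -leqNgt.
rewrite -sum1_card (partition_big f (mem S)) //= -sum_nat_const.
apply: leq_sum => z _; rewrite sum1dep_card ltnW // ltnNge.
by apply/negP => tz; apply: noz; exists z.
Qed.

(** * Complete multipartite subgraphs by Erdos-Stone induction *)

(** A vertex counts as non-adjacent to itself, so over the whole vertex set this is exactly [n]
    minus the degree. *)
Definition nonadj n (G : ograph n) (U : {set 'I_n}) (v : 'I_n) : nat :=
  #|[set y in U | ~~ G v y]|.

Definition complete n (G : ograph n) (A B : {set 'I_n}) : Prop :=
  forall a b, a \in A -> b \in B -> G a b.

(** Only the values of [A] below [k] matter. Distinct parts are disjoint because [G] is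
    irreflexive. *)
Definition blowup n (G : ograph n) k t (A : nat -> {set 'I_n}) : Prop :=
  (forall i, i < k -> #|A i| = t) /\
  (forall i j, i < k -> j < k -> i != j -> complete G (A i) (A j)).

Definition nbhd n (G : ograph n) (v : 'I_n) : {set 'I_n} := [set y | G v y].

(* Double counting non-adjacent pairs: with T = 2pt, at most a proportion
   (2p-2)/(2p-1) of U has fewer than t neighbours in some [A i]; pigeonhole then
   finds t of the others with the same neighbourhood in the union of the [A i]. *)
Lemma blowup_extend k p t : 0 < p -> 0 < t ->
  exists T u0, forall n (G : ograph n) (U : {set 'I_n}) A,
    u0 <= #|U| -> (forall v, k * nonadj G U v * p <= p.-1 * #|U|) ->
    blowup G k T A ->
    exists B, [/\ blowup G k.+1 t B, forall i, i < k -> B i \subset A i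
                & B k \subset U].
Proof.
move=> p0 t0; pose T := 2 * p * t.
(* The bound on [U] makes [#|U| / (2 * p)] exceed [2 ^ (k * T) * t], which is what pigeonhole over
   the subsets of [W] requires. *)
exists T, (2 * p * (2 ^ (k * T) * t)).+1 => n G U A Uge ndU [cA compA].
have tT : t <= T by rewrite /T; nia.
pose W := \bigcup_(i < k) A i.
pose good := [set y in U | [forall i : 'I_k, t <= #|A i :&: nbhd G y|]].
pose bad := U :\: good.
have cW : #|W| <= k * T.
  rewrite -[k in k * T]card_ord -sum_nat_const.
  rewrite -(eq_bigr _ (fun i _ => cA _ (ltn_ord i))).
  apply: (big_rec2 (fun (X : {set 'I_n}) s => #|X| <= s)) => [|i s X _ Xs].
    by rewrite cards0.
  by apply: leq_trans (leq_card_setU _ _) _; rewrite leq_add2l.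
pose nonadjA y i := #|[set a in A i | ~~ G a y]|.
have badP y : y \in bad -> T - t < \sum_(i < k) nonadjA y i.
  rewrite !inE => /andP[+ yU]; rewrite yU /= negb_forall => /existsP[i].
  rewrite -ltnNge => few; rewrite (bigD1 i) //= ltn_addr //.
  have := cardsID (nbhd G y) (A i); rewrite (cA _ (ltn_ord i)).
  have -> : A i :\: nbhd G y = [set a in A i | ~~ G a y].
    by apply/setP => a; rewrite !inE andbC adj_sym.
  by rewrite -/(nonadjA y i) => sumT; rewrite ltn_subLR // -[ltnLHS]sumT ltn_add2r.
have count : #|bad| * (T - t).+1 <= \sum_(i < k) \sum_(a in A i) nonadj G U a.
  rewrite -sum_nat_const.
  apply: (@leq_trans (\sum_(y in U) \sum_(i < k) nonadjA y i)).
    apply: (@leq_trans (\sum_(y in bad) \sum_(i < k) nonadjA y i)).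
      exact: leq_sum.
    rewrite [leqRHS](big_setID bad) /= (setIidPr _) ?leq_addr //.
    exact: subsetDl.
  rewrite exchange_big /=; apply: leq_sum => i _.
  rewrite /nonadjA /nonadj; under eq_bigr do rewrite -sum1dep_card.
  under [leqRHS]eq_bigr do rewrite -sum1dep_card.
  rewrite (exchange_big_dep (mem (A i))) /= => [|y a _ /andP[]//].
  by apply: leq_sum => a aA; rewrite aA.
(* The hypothesis on [nonadj G U] is summed over the [k * T] vertices of the parts and [k] is
   cancelled; for [k = 0] the sum is empty. *)
have count2 : p * \sum_(i < k) \sum_(a in A i) nonadj G U a <= T * (p.-1 * #|U|).
  have [->|k0] := posnP k; first by rewrite big_ord0 muln0.
  rewrite -(leq_pmul2l k0) [leqRHS]mulnA -[k in k * T]card_ord -sum_nat_const.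
  rewrite mulnA big_distrr big_distrl /=; apply: leq_sum => i _.
  rewrite -(cA _ (ltn_ord i)) -sum_nat_const big_distrr; apply: leq_sum => a _ /=.
  by rewrite mulnAC.
(* Since [T - t = (2 * p - 1) * t], cancelling [p * t] leaves [(2 * p - 1) * #|bad| <= (2 * p - 2) *
   #|U|], hence [#|U| <= 2 * p * #|good|]. *)
have good_large : 2 ^ (k * T) * t < #|good|.
  have : #|good| + #|bad| = #|U|.
    rewrite -(cardsID good U) (setIidPr _) //.
    by apply/subsetP => y; rewrite inE => /andP[].
  have {count count2} : p * (#|bad| * (T - t).+1) <= T * (p.-1 * #|U|).
    by apply: leq_trans count2; rewrite leq_mul2l count orbT.
  have -> : p * (#|bad| * (T - t).+1) = (p * #|bad|) * (T - t).+1 by lia.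
  move=> ineq eqU.
  have {ineq} : #|bad| * (2 * p).-1 <= 2 * p.-1 * #|U|.
    rewrite -(leq_pmul2l (m := p * t)) ?muln_gt0 ?p0 //.
    apply: (@leq_trans ((p * #|bad|) * (T - t).+1)).
      have -> : p * t * (#|bad| * (2 * p).-1) = (p * #|bad|) * (t * (2 * p).-1).
        by lia.
      by rewrite leq_mul2l /T; apply/orP; right; nia.
    by apply: leq_trans ineq _; rewrite /T leq_eqVlt; apply/orP; left; apply/eqP; lia.
  rewrite -eqU => ineq; rewrite ltnNge; apply/negP => few.
  have : #|good| + #|bad| <= 2 * p * #|good| by nia.
  rewrite eqU => /(leq_trans Uge); rewrite ltnNge => /negP; apply.
  by rewrite leq_mul2l few orbT.
have [||z tz] := pigeonhole (f := fun y => nbhd G y :&: W) (A := good)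
    (S := powerset W) (t := t).
- by move=> y _; rewrite inE subsetIr.
- rewrite card_powerset; apply: leq_ltn_trans good_large.
  by rewrite leq_mul2r leq_pexp2l ?orbT.
have [y0] : exists y, y \in [set y in good | nbhd G y :&: W == z].
  by apply/card_gt0P; apply: leq_trans tz.
rewrite !inE => /andP[/andP[y0U /forallP y0good] /eqP y0z].
pose B i := subset_of_size t (if i < k then A i :&: nbhd G y0
                              else [set y in good | nbhd G y :&: W == z]).
have BA i : i < k -> B i \subset A i :&: nbhd G y0.
  by move=> ik; rewrite /B ik subset_of_size_sub.
have Bk : B k \subset [set y in good | nbhd G y :&: W == z].
  by rewrite /B ltnn subset_of_size_sub.
(* A neighbour of [y0] in [A i] lies in the common trace [z] on [W], so every vertex of [B k] is
   adjacent to it. *)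
have compBk i : i < k -> complete G (B i) (B k).
  move=> ik a y /(subsetP (BA i ik)) aAN /(subsetP Bk).
  move: aAN; rewrite !inE => /andP[aA y0a] /andP[_ /eqP yz].
  have : a \in nbhd G y0 :&: W.
    rewrite !inE y0a /=; apply/bigcupP; by exists (Ordinal ik).
  by rewrite y0z -yz !inE adj_sym => /andP[].
exists B; split; first split.
- move=> i; rewrite ltnS leq_eqVlt => /orP[/eqP->|ik].
    by rewrite /B ltnn card_subset_of_size.
  by rewrite /B ik card_subset_of_size //; apply: (y0good (Ordinal ik)).
- move=> i j; rewrite ltnS leq_eqVlt => /orP[/eqP->|ik];
    rewrite ltnS leq_eqVlt => /orP[/eqP->|jk]; first by rewrite eqxx.
  + by move=> _ a b aB bB; rewrite adj_sym; apply: (compBk j).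
  + by move=> _; apply: compBk.
  + move=> ij a b /(subsetP (BA i ik)) /setIP[aA _] /(subsetP (BA j jk)) /setIP[bA _].
    exact: (compA i j).
- by move=> i ik; apply: subset_trans (BA i ik) (subsetIl _ _).
- by apply: subset_trans Bk _; apply/subsetP => y; rewrite !inE => /andP[/andP[]].
Qed.

(** Induction on the number of parts. When a part is added to [k] others, [k <= m], so the bound
    with factor [m] implies the one [blowup_extend] asks for. *)
Lemma blowup_in k m p t : 0 < p -> 0 < t -> k <= m.+1 ->
  exists u0, forall n (G : ograph n) (U : {set 'I_n}),
    u0 <= #|U| -> (forall v, m * nonadj G U v * p <= p.-1 * #|U|) ->
    exists A, blowup G k t A /\ forall i, i < k -> A i \subset U.
Proof.
move=> p0; elim: k t => [|k IHk] t t0 km.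
  by exists 0 => n G U _ _; exists (fun=> set0).
have [T [u1 ext]] := blowup_extend k p0 t0.
(* [blowup_extend] does not state that [T] is positive, so parts of size [T.+1] are built and then
   trimmed. *)
have [|u2 IH] := IHk T.+1 isT; first exact: ltnW.
exists (maxn u1 u2) => n G U; rewrite geq_max => /andP[U1 U2] ndU.
have [A [[cA compA] AU]] := IH n G U U2 ndU.
pose A' i := subset_of_size T (A i).
have A'A i : A' i \subset A i by apply: subset_of_size_sub.
have [v||B [blB BA BU]] := ext n G U A' U1.
- by apply: leq_trans (ndU v); rewrite !leq_mul2r -[k <= m]ltnS km !orbT.
- split=> [i ik|i j ik jk ij a b /(subsetP (A'A i)) aA /(subsetP (A'A j)) bA].
    by rewrite card_subset_of_size // cA.
  exact: (compA i j).
exists B; split=> // i; rewrite ltnS leq_eqVlt => /orP[/eqP->//|ik].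
exact: subset_trans (BA i ik) (subset_trans (A'A i) (AU i ik)).
Qed.

Lemma degree_nonadj n (G : ograph n) v : degree G v + nonadj G setT v = n.
Proof.
rewrite -[RHS]card_ord -cardsT -(cardsID (nbhd G v) setT) setTI; congr (_ + _).
by apply: eq_card => y; rewrite !inE andbC.
Qed.

(** The degree bound passes to the neighbourhood of [x] at the price of one unit in the factor
    [m.+1]: that unit pays for the vertices outside the neighbourhood. *)
Lemma blowup_in_nbhd m p t : 0 < p -> 0 < t ->
  exists n0, forall n (G : ograph n) x, n0 <= n ->
    (forall v, m.+1 * nonadj G setT v * p <= p.-1 * n) ->
    exists A, blowup G m.+1 t A /\ forall i, i < m.+1 -> A i \subset nbhd G x.
Proof.
move=> p0 t0; have [u0 bl] := blowup_in p0 t0 (leqnn m.+1).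
(* [x] misses at most a proportion [1 - 1/p] of the vertices, so it has at least [n / p >= u0]
   neighbours. *)
exists (p * u0) => n G x n0 nd; apply: bl => [|v].
  rewrite -(leq_pmul2l p0); apply: leq_trans n0 _.
  move: (degree_nonadj G x) (nd x); rewrite /degree -/(nbhd G x).
  move: #|nbhd G x| (nonadj G setT x) => a b ab ndx.
  have : b * p <= p.-1 * n by apply: leq_trans ndx; rewrite -mulnA mulSn leq_addr.
  by rewrite -ab; nia.
have sub : nonadj G (nbhd G x) v <= nonadj G setT v.
  by apply: subset_leq_card; apply/subsetP => y; rewrite !inE => /andP[_ ->].
move: (degree_nonadj G x) (nd x) (nd v) sub; rewrite /degree -/(nbhd G x).
move: #|nbhd G x| (nonadj G setT x) (nonadj G setT v) (nonadj G (nbhd G x) v).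
(* Here [e] is the larger of the numbers of vertices missed by [x] and by [v]; one summand [e * p]
   absorbs [p.-1 * b]. *)
move=> a b c d ab ndx ndv dc; suff h e :
    b <= e -> c <= e -> m.+1 * e * p <= p.-1 * n -> m * d * p <= p.-1 * a.
  by have [bc|/ltnW cb] := leqP b c; [apply: (h c) | apply: (h b)].
rewrite -ab mulnDr => be ce; have de := leq_trans dc ce.
have : p.-1 * b <= e * p by rewrite mulnC leq_mul // leq_pred.
have : m * d * p <= m * e * p by rewrite leq_mul2r leq_mul2l de !orbT.
by rewrite mulSn mulnDl; lia.
Qed.

(** * Arranging blocks one after another *)

(** Boolean form of [set_lt], so that [pairwise] applies to it. *)
Definition set_ltb n (A B : {set 'I_n}) : bool :=
  [forall a in A, forall b in B, a < b].

Lemma set_ltbP n (A B : {set 'I_n}) : reflect (set_lt A B) (set_ltb A B).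
Proof.
apply: (iffP forall_inP) => [lt a b /lt/forall_inP|lt a aA]; first exact.
by apply/forall_inP => b; apply: lt.
Qed.

(* Greedy: the block whose [t]-th smallest element is least comes first; below
   that element every other set has lost at most [t] elements. *)
Lemma order_blocks n t s (A : nat -> {set 'I_n}) :
  0 < t -> uniq s -> (forall i, i \in s -> size s * t <= #|A i|) ->
  exists (s' : seq nat) (B : nat -> {set 'I_n}), [/\ perm_eq s' s,
    forall i, i \in s -> B i \subset A i /\ #|B i| = t
    & pairwise (fun i j => set_ltb (B i) (B j)) s'].
Proof.
move=> t0; move: {2}(size s) (erefl (size s)) => k.
elim: k s A => [|k IHk] s A sz us cA.
  by rewrite (size0nil sz); exists [::], A.
pose below i c := [set y in A i | y < c].
have belowS i c : #|below i c.+1| <= (#|below i c|).+1.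
  have -> : below i c.+1 = below i c :|: [set y in A i | c <= y < c.+1].
    apply/setP => y; rewrite !inE -andb_orr; congr (_ && _); lia.
  apply: leq_trans (leq_card_setU _ _) _; rewrite -[leqRHS]addn1 leq_add2l.
  apply: leq_trans (leq_trans (card_range n c c.+1) _); last lia.
  by apply: subset_leq_card; apply/subsetP => y; rewrite !inE => /andP[].
have : exists c, has (fun i => t <= #|below i c|) s.
  exists n; apply/hasP; case: s sz us cA => // i s sz us cA.
  exists i; first exact: mem_head.
  have -> : below i n = A i by apply/setP => y; rewrite !inE ltn_ord andbT.
  by apply: leq_trans (cA i (mem_head _ _)); rewrite sz mulSn leq_addr.
move=> /find_ex_minn[c /hasP[i0 i0s i0c] cmin].
(* By minimality of [c], fewer than [t] elements lie below [c - 1], and passing to [c] adds at most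
   one. *)
have below_t j : j \in s -> #|below j c| <= t.
  move=> js; case: c cmin {i0c} => [|c] cmin.
    by rewrite (_ : below j 0 = set0) ?cards0 //; apply/setP => y; rewrite !inE andbF.
  apply: leq_trans (belowS j c) _; rewrite ltnNge; apply/negP => tb.
  by have := cmin c; rewrite ltnn => /(_ _)/negP; apply=> //; apply/hasP; exists j.
pose A' j := A j :\: below j c.
have [||j js|s' [B [ps BA pB]]] := IHk (rem i0 s) A'.
- by rewrite size_rem // sz.
- exact: rem_uniq.
- rewrite size_rem // sz /= -(leq_add2l t) -mulSn -sz.
  apply: leq_trans (cA j (mem_rem js)) _.
  rewrite -(cardsID (below j c) (A j)) leq_add2r.
  apply: leq_trans (subset_leq_card (subsetIr _ _)) _.
  exact: below_t (mem_rem js).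
pose B' j := if j == i0 then subset_of_size t (below i0 c) else B j.
have i0s' : i0 \notin s' by rewrite (perm_mem ps) mem_rem_uniq // !inE eqxx.
exists (i0 :: s'), B'; split.
- rewrite perm_sym; apply: perm_trans (perm_to_rem i0s) _.
  by rewrite perm_cons perm_sym.
- move=> i si; rewrite /B'; case: eqP => [->|/eqP ne].
    split; last exact: card_subset_of_size.
    apply: subset_trans (subset_of_size_sub _ _) _.
    by apply/subsetP => y; rewrite !inE => /andP[].
  have [|BA' cB] := BA i; first by rewrite mem_rem_uniq // !inE ne.
  by split=> //; apply: subset_trans BA' (subsetDl _ _).
rewrite pairwise_cons; apply/andP; split.
  apply/allP => j js'; rewrite /B' eqxx.
  case: eqP => [ji|_]; first by rewrite -ji js' in i0s'.
  apply/set_ltbP => a b /(subsetP (subset_of_size_sub _ _)); rewrite !inE.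
  have [|BA' _] := BA j; first by rewrite -(perm_mem ps).
  by move=> /andP[_ ac] /(subsetP BA'); rewrite !inE => /andP[+ bA]; rewrite bA /=; lia.
rewrite (_ : pairwise _ s' = pairwise (fun i j => set_ltb (B i) (B j)) s') //.
apply: (@eq_in_pairwise _ (mem s')); last exact/allP.
move=> i j /= si sj; rewrite /B'.
case: eqP => [e|_]; first by rewrite -e si in i0s'.
by case: eqP => [e|_] //; rewrite -e sj in i0s'.
Qed.

(** Apart from [x] itself, each set has at least [m * t] elements on one side of [x]. The sets rich
    below [x] are ordered there by [order_blocks], the others above it. Index [m] stands for the
    singleton of [x]. *)
Lemma order_around n t m (x : 'I_n) (A : nat -> {set 'I_n}) :
  0 < t -> (forall i, i < m -> (2 * (m * t)).+1 <= #|A i|) ->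
  exists (L : seq nat) (B : nat -> {set 'I_n}), [/\ perm_eq L (iota 0 m.+1),
    B m = [set x], forall i, i < m -> B i \subset A i /\ #|B i| = t
    & pairwise (fun i j => set_ltb (B i) (B j)) L].
Proof.
move=> t0 cA.
pose lo i := [set y in A i | y < x]; pose hi i := [set y in A i | x < y].
pose s1 := [seq i <- iota 0 m | m * t <= #|lo i|].
pose s2 := [seq i <- iota 0 m | ~~ (m * t <= #|lo i|)].
have [||s1' [B1 [p1 BA1 lt1]]] := @order_blocks n t s1 lo t0.
- by rewrite filter_uniq ?iota_uniq.
- move=> i; rewrite mem_filter => /andP[+ _]; apply: leq_trans.
  by rewrite leq_mul2r -[leqRHS](size_iota 0 m) size_filter count_size orbT.
have [||s2' [B2 [p2 BA2 lt2]]] := @order_blocks n t s2 hi t0.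
- by rewrite filter_uniq ?iota_uniq.
- move=> i; rewrite mem_filter mem_iota add0n -ltnNge => /andP[few im].
  apply: (@leq_trans (m * t)).
    by rewrite leq_mul2r -[leqRHS](size_iota 0 m) size_filter count_size orbT.
  have : #|A i| <= #|lo i| + #|hi i| + 1.
    have sub : A i \subset (lo i :|: hi i) :|: [set x].
      apply/subsetP => y yA; rewrite !inE yA -val_eqE /=.
      by case: ltngtP.
    apply: leq_trans (subset_leq_card sub) _.
    apply: leq_trans (leq_card_setU _ _) _.
    by rewrite cards1 leq_add2r leq_card_setU.
  have := cA i im; lia.
pose B i := if i == m then [set x] else if i \in s1 then B1 i else B2 i.
have s1m i : i \in s1' -> (i == m) = false.
  rewrite (perm_mem p1) mem_filter mem_iota add0n => /andP[_ im].
  by rewrite ltn_eqF.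
have s2m i : i \in s2' -> (i == m) = false /\ (i \in s1) = false.
  rewrite (perm_mem p2) !mem_filter mem_iota add0n => /andP[/negPf-> im].
  by rewrite ltn_eqF.
have BE1 i : i \in s1' -> B i = B1 i.
  by move=> i1; rewrite /B s1m // -(perm_mem p1) i1.
have BE2 i : i \in s2' -> B i = B2 i.
  by move=> /s2m[im i1]; rewrite /B im i1.
have lo_lt i y : i \in s1' -> y \in B i -> y < x.
  move=> i1; rewrite BE1 //; case: (BA1 i); first by rewrite -(perm_mem p1).
  by move=> /subsetP BA _ /BA; rewrite inE => /andP[].
have hi_gt i y : i \in s2' -> y \in B i -> x < y.
  move=> i2; rewrite BE2 //; case: (BA2 i); first by rewrite -(perm_mem p2).
  by move=> /subsetP BA _ /BA; rewrite inE => /andP[].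
have Bm : B m = [set x] by rewrite /B eqxx.
exists (s1' ++ m :: s2'), B; split=> //.
- rewrite -addn1 iotaD /= add0n -cat1s perm_catCA perm_sym perm_catC /= perm_cons.
  rewrite perm_sym (perm_trans (perm_cat p1 p2)) //.
  by apply/permPl/perm_filterC.
- move=> i im.
  rewrite /B ltn_eqF //; case: ifPn => i1.
    have [BA cB] := BA1 i i1; split=> //; apply: subset_trans BA _.
    by apply/subsetP => y; rewrite inE => /andP[].
  have [|BA cB] := BA2 i.
    by move: i1; rewrite !mem_filter mem_iota add0n im !andbT.
  split=> //; apply: subset_trans BA _.
  by apply/subsetP => y; rewrite inE => /andP[].
- rewrite pairwise_cat pairwise_cons; apply/and4P; split.
  + apply/allrelP => i j i1; rewrite inE => /predU1P[->|j2].
      by apply/set_ltbP => a b aB; rewrite Bm => /set1P->; apply: lo_lt aB.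
    by apply/set_ltbP => a b /(lo_lt _ _ i1) ax /(hi_gt _ _ j2); apply: ltn_trans.
  + rewrite (@eq_in_pairwise _ (mem s1') _ (fun i j => set_ltb (B1 i) (B1 j))) //.
      by move=> i j ? ?; rewrite !BE1.
  + apply/allP => j j2; apply/set_ltbP => a b.
    by rewrite Bm => /set1P-> /(hi_gt _ _ j2).
  + rewrite (@eq_in_pairwise _ (mem s2') _ (fun i j => set_ltb (B2 i) (B2 j))) //.
      by move=> i j ? ?; rewrite !BE2.
Qed.

(** * Interval colourings and embeddings through a given vertex *)

Lemma sorted_enum_ord n (A : {set 'I_n}) :
  sorted (fun a b : 'I_n => a < b) (enum A).
Proof.
rewrite {1}/enum_mem -enumT; apply: sorted_filter.
  by move=> a b c; apply: ltn_trans.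
have := iota_ltn_sorted 0 n; rewrite -val_enum_ord sorted_map.
by [].
Qed.

(** Together with [fun_colouring], this lets interval colourings be handled as monotone proper maps
    to ['I_k]. A vertex in two classes would be smaller than itself by [set_lt]. *)
Lemma colouring_fun h (H : ograph h) k (V : 'I_k -> {set 'I_h}) :
  interval_colouring H V -> exists c : 'I_h -> 'I_k,
    [/\ forall u i, (u \in V i) = (c u == i),
        forall u w : 'I_h, u <= w -> c u <= c w
      & forall u w, H u w -> c u != c w].
Proof.
case=> /choice[c cV] _ ltV proper.
have VE u i : (u \in V i) = (c u == i).
  apply/idP/eqP => [uV|<-//]; apply/val_inj => /=.
  by have [lt|lt|//] := ltngtP (c u) i; have := ltV _ _ lt u u;
    rewrite ltnn => /(_ _ _)/negP[].
exists c; split=> // u w.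
  move=> uw; rewrite leqNgt; apply/negP => lt.
  by have := ltV _ _ lt w u (cV w) (cV u); rewrite ltnNge uw.
apply: contraTN => /eqP cuw; apply: (proper (c w)); rewrite VE ?cuw //.
Qed.

Lemma fun_colouring h (H : ograph h) k (c : 'I_h -> 'I_k) :
  (forall u w : 'I_h, u < w -> c u <= c w) ->
  (forall u w, H u w -> c u != c w) ->
  interval_colouring H (fun i => [set u | c u == i]).
Proof.
move=> mono proper; have mono' (u w : 'I_h) : u <= w -> c u <= c w.
  by rewrite leq_eqVlt => /orP[/eqP/val_inj->|/mono].
split.
- by move=> u; exists (c u); rewrite inE.
- move=> i u w z; rewrite !inE => /eqP ui /eqP zi /andP[/mono' uw /mono' wz].
  by rewrite -val_eqE eqn_leq -{1}zi wz -ui uw.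
- move=> i j ij u w; rewrite !inE => /eqP ui /eqP wj; rewrite ltnNge.
  by apply/negP => /mono'; rewrite ui wj leqNgt ij.
- move=> i u w; rewrite !inE => /eqP ui /eqP wi; apply/negP => /proper.
  by rewrite ui wi eqxx.
Qed.

(** Vertices are matched by rank inside each class, and the order of the blocks does the rest.
    Completeness is asked only between classes that span an edge of [H], which leaves room for a
    block not joined to [x]. *)
Lemma copy_of_blocks h (H : ograph h) n (G : ograph n) (x : 'I_n) k
    (V : 'I_k -> {set 'I_h}) (W : 'I_k -> {set 'I_n}) :
  interval_colouring H V -> (forall c, #|V c| <= #|W c|) ->
  (forall c d : 'I_k, c < d -> set_lt (W c) (W d)) ->
  (forall c d u w, c != d -> u \in V c -> w \in V d -> H u w ->
     complete G (W c) (W d)) ->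
  exists phi, is_copy H G phi /\ forall c u, u \in V c -> phi u \in W c.
Proof.
move=> colV cVW ltW compW; have [c [VE mono proper]] := colouring_fun colV.
(* [x] is a default value for [nth], never reached by [idx]. *)
pose phi u := nth x (enum (W (c u))) (index u (enum (V (c u)))).
have uV u : u \in V (c u) by rewrite VE.
have idx u : index u (enum (V (c u))) < size (enum (W (c u))).
  by rewrite -cardE (leq_trans _ (cVW _)) // cardE index_mem mem_enum.
have phiW u : phi u \in W (c u) by rewrite -mem_enum mem_nth.
have phi_lt (u w : 'I_h) : u < w -> phi u < phi w.
  move=> uw; have := mono u w (ltnW uw); rewrite leq_eqVlt.
  case/orP=> [/eqP/val_inj cuw|/ltW]; last by apply; apply: phiW.
  rewrite /phi cuw.
  apply: (sorted_ltn_nth _ x (sorted_enum_ord (W (c w)))).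
  - by move=> a b d; apply: ltn_trans.
  - by rewrite inE -cuw idx.
  - by rewrite inE idx.
  have [//|wu|eq] := ltngtP (index u _) (index w _).
    have lt_tr : transitive (fun a b : 'I_h => a < b).
      by move=> a b d; apply: ltn_trans.
    have := sorted_ltn_index lt_tr (sorted_enum_ord (V (c w))).
    move=> /(_ w u); rewrite !mem_enum uV -cuw uV cuw => /(_ isT isT wu).
    by rewrite ltnNge (ltnW uw).
  have uw_eq : u = w by apply: (index_inj u _ _ eq); rewrite mem_enum // -cuw.
  by rewrite uw_eq ltnn in uw.
exists phi; split; last by move=> d u; rewrite VE => /eqP<-.
split=> //.
  move=> u w uw; apply/val_inj => /=.
  by have [/phi_lt|/phi_lt|//] := ltngtP u w; rewrite uw ltnn.
by move=> u w uw; apply: (compW (c u) (c w) u w) => //; apply: proper.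
Qed.

Lemma complete_sym n (G : ograph n) A B : complete G A B -> complete G B A.
Proof. by move=> AB a b aB bA; rewrite adj_sym; apply: AB. Qed.

(** Cut at the first vertex [v] of colour at least [i], or at the last vertex if there is none:
    earlier vertices keep their colours, [v] receives [i], and later colours go up by one. *)
Lemma split_colouring h (H : ograph h) k (V : 'I_k -> {set 'I_h}) :
  0 < h -> interval_colouring H V -> forall i : 'I_k.+1,
  exists (V' : 'I_k.+1 -> {set 'I_h}) v, interval_colouring H V' /\ V' i = [set v].
Proof.
move=> h0 colV i; have [c [_ mono proper]] := colouring_fun colV.
have [v [ltv gtv]] : exists v : 'I_h,
    (forall u : 'I_h, u < v -> c u < i) /\ (forall u : 'I_h, v < u -> i <= c u).
  case: (pickP (fun u => i <= c u)) => [u0 iu0|no].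
    exists [arg min_(u < u0 | i <= c u) u]; case: arg_minnP => // v iv vmin.
    split=> u; last by move=> /ltnW/mono; apply: leq_trans.
    by rewrite !ltnNge; apply: contraNN => /vmin.
  have hlt : h.-1 < h by rewrite prednK.
  exists (Ordinal hlt); split=> u; first by move=> _; rewrite ltnNge; apply/negbT/no.
  by rewrite /= => hu; have := leq_ltn_trans hu (ltn_ord u); rewrite prednK // ltnn.
have lt1 u : c u < k.+1 by apply: ltnW; rewrite ltnS.
have lt2 u : (c u).+1 < k.+1 by rewrite ltnS.
pose c' (u : 'I_h) :=
  if u < v then Ordinal (lt1 u) else if u == v then i else Ordinal (lt2 u).
exists (fun j => [set u | c' u == j]), v; split.
  apply: fun_colouring => [u w uw|u w uw].
    have := mono u w (ltnW uw); rewrite /c' -!val_eqE /=.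
    have := ltv u; have := gtv w; have := ltv w; have := gtv u.
    by case: (ltngtP u v); case: (ltngtP w v) => //=; lia.
  move: (proper u w uw); rewrite /c' -!val_eqE /= => cuw.
  have ne : u != w :> nat.
    by apply: contraTneq uw => /val_inj ->; rewrite adj_irr.
  have := ltv u; have := gtv w; have := ltv w; have := gtv u.
  by case: (ltngtP u v); case: (ltngtP w v) => //=; lia.
apply/setP => u; rewrite !inE /c'; have := gtv u; have := ltv u.
by rewrite -!val_eqE; case: (ltngtP u v) => //=; lia.
Qed.

(* [x] is joined to all blocks except possibly [A j0]; taking [j0 >= r] covers
   the case where it is joined to all of them. *)
Lemma cover_vertex h (H : ograph h) n (G : ograph n) (x : 'I_n) r j0
    (A : nat -> {set 'I_n}) :
  0 < h -> 0 < r -> blowup G r (2 * (r * h)).+1 A ->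
  (forall i, i < r -> i != j0 -> A i \subset nbhd G x) ->
  (forall i j : 'I_r.+1, i != j -> exists (V : 'I_r.+1 -> {set 'I_h}) v,
     [/\ interval_colouring H V, V i = [set v]
       & j0 < r -> forall w, w \in V j -> ~~ H v w]) ->
  exists phi, is_copy H G phi /\ exists i, phi i = x.
Proof.
move=> h0 r0 [cA compA] Ax bar.
have [|L [B [pL Br BA ltB]]] := @order_around n h r x A h0.
  by move=> i ir; rewrite cA.
have sL : size L = r.+1 by rewrite (perm_size pL) size_iota.
have uL : uniq L by rewrite (perm_uniq pL) iota_uniq.
have inL a : (a \in L) = (a < r.+1) by rewrite (perm_mem pL) mem_iota.
have idL a : a < r.+1 -> index a L < r.+1 by rewrite -inL -sL index_mem.
(* With no exceptional block, [0] is a dummy choice that only has to differ from the index [r] of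
   [x]. *)
pose j1 := if j0 < r then j0 else 0.
have j1r : j1 < r by rewrite /j1; case: ifP.
(* [i] and [j] are the positions of [x] and of the exceptional block along the line; [a c] below is
   the block at position [c]. *)
pose i := Ordinal (idL r (ltnSn r)); pose j := Ordinal (idL j1 (ltnW j1r)).
pose a c := nth 0 L c.
have ai : a i = r by rewrite /a nth_index ?inL.
have aj : a j = j1 by rewrite /a nth_index ?inL // ltnW.
have a_inj (c d : 'I_r.+1) : a c = a d -> c = d.
  by move/eqP; rewrite nth_uniq ?sL // => /eqP/val_inj.
have a_le (c : 'I_r.+1) : a c < r.+1 by rewrite -inL mem_nth ?sL.
have [|V [v [colV Vi Hv]]] := bar i j.
  apply/eqP => /(congr1 (fun c : 'I_r.+1 => a c)); rewrite ai aj => rj.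
  by have := j1r; rewrite -[ltnLHS]rj ltnn.
have a_lt (c : 'I_r.+1) : c != i -> a c < r.
  move=> ci; have := a_le c; rewrite ltnS leq_eqVlt => /orP[/eqP e|//].
  by case/eqP: ci; apply: a_inj; rewrite ai.
have nbB c w : c != i -> w \in V c -> H v w -> complete G [set x] (B (a c)).
  move=> ci wc vw _ y /set1P-> /(subsetP (BA _ (a_lt c ci)).1).
  have [ej|ne] := eqVneq (a c) j0; last first.
    by move/(subsetP (Ax _ (a_lt c ci) ne)); rewrite inE.
  have jr : j0 < r by rewrite -ej a_lt.
  have cj : c = j by apply: a_inj; rewrite aj /j1 jr.
  by move: (Hv jr w); rewrite -cj vw => /(_ wc).
have [|||phi [copy phiW]] := @copy_of_blocks h H n G x r.+1 V (fun c => B (a c)) colV.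
- move=> c; have [->|ci] := eqVneq c i; first by rewrite Vi ai Br !cards1.
  by rewrite (BA _ (a_lt c ci)).2 -[leqRHS]card_ord max_card.
- move=> c d cd; apply/set_ltbP.
  by move/(pairwiseP 0): ltB; apply; rewrite ?inE ?sL.
- move=> c d u w cd uV wV uw.
  have [ci|ci] := eqVneq c i.
    rewrite ci ai Br; apply: (nbB d w) => //; first by rewrite -ci eq_sym.
    by move: uV; rewrite ci Vi => /set1P<-.
  have [di|di] := eqVneq d i.
    rewrite di ai Br; apply/complete_sym/(nbB c u) => //.
    by move: wV; rewrite di Vi => /set1P<-; rewrite adj_sym.
  move=> y z /(subsetP (BA _ (a_lt c ci)).1) yA /(subsetP (BA _ (a_lt d di)).1).
  apply: compA yA; rewrite ?a_lt //.
  by apply: contraNneq cd => /a_inj->.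
exists phi; split=> //; exists v.
by apply/set1P; rewrite -Br -ai phiW // Vi set11.
Qed.

(** * Extremal properties of [interval_chi], [min_degree] and [delta_cov] *)

Lemma interval_chi_colouring h (H : ograph h) :
  exists V : 'I_(interval_chi H) -> {set 'I_h}, interval_colouring H V.
Proof. by rewrite /interval_chi; case: ex_minnP => r /asboolP. Qed.

Lemma interval_chi_le h (H : ograph h) k (V : 'I_k -> {set 'I_h}) :
  interval_colouring H V -> interval_chi H <= k.
Proof.
move=> colV; rewrite /interval_chi; case: ex_minnP => r _; apply.
by apply/asboolP; exists V.
Qed.

Lemma interval_chi_ord0 h (H : ograph h) : 0 < interval_chi H -> 0 < h.
Proof.
case: h H => // H; apply: contraTT => _; rewrite -leqNgt.
apply: (@interval_chi_le _ _ _ (fun=> set0)).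
by split=> [[]|[]|[]|[]].
Qed.

Lemma min_degree_le n (G : ograph n) x : min_degree G <= degree G x.
Proof.
rewrite /min_degree; elim: (index_enum _) (mem_index_enum x) => //= y s IHs.
rewrite big_cons inE geq_min => /predU1P[<-|/IHs->]; last exact: orbT.
by rewrite leqnn.
Qed.

Lemma leq_min_degree n (G : ograph n) d :
  d <= n -> (forall x, d <= degree G x) -> d <= min_degree G.
Proof.
move=> dn ddeg; apply: (big_ind (leq d)) => // a b da db.
by rewrite leq_min da.
Qed.

Lemma delta_cov_le h (H : ograph h) n k :
  cover_threshold H n k -> delta_cov H n <= k.
Proof.
by move=> thr; rewrite /delta_cov; case: ex_minnP => d _; apply; apply/asboolP.
Qed.

Lemma lt_delta_cov h (H : ograph h) n (G : ograph n) d :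
  d <= min_degree G -> ~ has_cover H G -> d < delta_cov H n.
Proof.
move=> dG nocov; rewrite /delta_cov; case: ex_minnP => k /asboolP thr _.
by rewrite ltnNge; apply/negP => kd; apply/nocov/thr/(leq_trans kd).
Qed.

(** * Lower bounds: interval-multipartite constructions *)

(* The [n] vertices are a window of the concatenated blocks, shifted so as to
   meet block [i]. *)
Lemma interval_partition k (sz : 'I_k -> nat) (i : 'I_k) n :
  0 < sz i -> 0 < n -> n <= \sum_j sz j ->
  exists c : 'I_n -> 'I_k,
    [/\ forall y z : 'I_n, y < z -> c y <= c z,
        forall j, #|[set y | c y == j]| <= sz j
      & exists x, c x = i].
Proof.
move=> szi n0 nsz; pose S j := \sum_(l < k | l < j) sz l.
have Sk : S k = \sum_j sz j by apply: eq_bigl => j; rewrite ltn_ord.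
have SS (j : 'I_k) : S j.+1 = S j + sz j.
  rewrite /S (bigD1 j) //= addnC; congr (_ + _); apply: eq_bigl => l.
  by rewrite ltnS ltn_neqAle andbC.
have Smono a b : a <= b -> S a <= S b.
  move=> ab; rewrite /S [leqRHS](bigID (fun l : 'I_k => l < a)) /=.
  apply: leq_trans (leq_addr _ _); rewrite leq_eqVlt; apply/orP; left; apply/eqP.
  by apply: eq_bigl => l; case: (ltnP l a) => la; rewrite ?andbF // (leq_trans la).
have block s l : l <= k -> s < S l -> exists j : 'I_k, S j <= s < S j.+1.
  elim: l => [|l IHl] lk; first by rewrite {1}/S big_pred0.
  have [sl _|sl sl1] := ltnP s (S l); first by apply: IHl => //; apply: ltnW.
  by exists (Ordinal lk); rewrite sl.
(* The window of length [n] from [a] has [S i], the first position of block [i], as its last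
   element, or starts at [0] when [S i < n]. *)
pose a := (S i).+1 - n.
have Si : S i < S k by apply: leq_trans (Smono i.+1 k (ltn_ord i)); rewrite SS; lia.
have slot (y : 'I_n) : y + a < S k by have := ltn_ord y; rewrite /a; lia.
have /choice[c cP] : forall y : 'I_n, exists j : 'I_k, S j <= y + a < S j.+1.
  by move=> y; apply: (block _ k).
exists c; split.
- move=> y z yz; rewrite leqNgt; apply/negP => /Smono.
  by have := cP y; have := cP z; lia.
- move=> j; apply: leq_trans (_ : S j.+1 - a - (S j - a) <= _); last first.
    by rewrite SS; lia.
  apply: leq_trans (card_range n _ _); apply: subset_leq_card.
  by apply/subsetP => y; rewrite !inE => /eqP <-; have := cP y; lia.
have xn : S i - a < n by rewrite /a; lia.
exists (Ordinal xn); apply/val_inj => /=; have /= := cP (Ordinal xn).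
have -> : S i - a + a = S i by rewrite /a; lia.
case/andP=> c1 c2; have [lt|lt|//] := ltngtP (c (Ordinal xn)) i.
  by have := Smono _ _ lt; lia.
by have := Smono _ _ lt; rewrite SS; lia.
Qed.

(** Blow-up of a reduced graph [M] along the classes of [c]; both constructions have this form. *)
Definition class_graph n k (M : rel 'I_k) (Msym : symmetric M)
    (Mirr : irreflexive M) (c : 'I_n -> 'I_k) : ograph n :=
  OGraph (fun y z : 'I_n => Msym (c y) (c z)) (fun y => Mirr (c y)).

Lemma copy_class_graph h (H : ograph h) n k (M : rel 'I_k) Msym Mirr
    (c : 'I_n -> 'I_k) phi :
  (forall y z : 'I_n, y < z -> c y <= c z) ->
  is_copy H (@class_graph n k M Msym Mirr c) phi ->
  interval_colouring H (fun i => [set u | c (phi u) == i]).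
Proof.
move=> mono [_ phi_lt phi_adj].
apply: fun_colouring => u w => [/phi_lt/mono//|/phi_adj /= Muw].
by apply: contraTneq Muw => /= ->; rewrite Mirr.
Qed.

Lemma class_graph_lt_delta_cov h (H : ograph h) n k (M : rel 'I_k) Msym Mirr
    (c : 'I_n -> 'I_k) q :
  (forall y, #|[set z | ~~ M (c y) (c z)]| <= q) ->
  ~ has_cover H (@class_graph n k M Msym Mirr c) -> n - q < delta_cov H n.
Proof.
move=> ndq; apply: lt_delta_cov; apply: leq_min_degree => [|y]; first exact: leq_subr.
rewrite -[n in n - q](degree_nonadj (class_graph Msym Mirr c) y).
rewrite leq_subLR [leqRHS]addnC leq_add2l.
by apply: leq_trans (ndq y); apply: subset_leq_card; apply/subsetP => z; rewrite !inE.
Qed.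

(** For positive [n] and [m], [(n.-1 %/ m).+1] is the ceiling of [n / m], the largest part size in
    both constructions. *)
Lemma sum_leq_mul_ceil n m : 0 < n -> 0 < m -> n <= m * (n.-1 %/ m).+1.
Proof. by move=> n0 m0; have := ltn_ceil n.-1 m0; rewrite mulnC; lia. Qed.

Lemma delta_cov_lower h (H : ograph h) n m :
  0 < n -> 0 < m -> m < interval_chi H ->
  n - (n.-1 %/ m).+1 < delta_cov H n.
Proof.
move=> n0 m0 mchi; set q := (_ %/ _).+1.
pose sz (_ : 'I_m) := q.
(* The block to be met is arbitrary: it only supplies some vertex [x], since the graph contains no
   copy at all. *)
have [|c [mono csz [x cx]]] := @interval_partition m sz (Ordinal m0) n isT n0.
  by rewrite sum_nat_const card_ord sum_leq_mul_ceil.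
pose M (a b : 'I_m) := a != b.
have Msym : symmetric M by move=> a b; rewrite /M eq_sym.
have Mirr : irreflexive M by move=> a; rewrite /M eqxx.
apply: (@class_graph_lt_delta_cov _ _ _ _ M Msym Mirr c).
  move=> y; apply: leq_trans (csz (c y)); apply: subset_leq_card.
  by apply/subsetP => z; rewrite !inE negbK eq_sym.
move=> /(_ x)[phi [copy _]].
by have := interval_chi_le (copy_class_graph mono copy); rewrite leqNgt mchi.
Qed.

(** Part sizes [1] for [i], [q - 1] for [j] and [q] for the other [r - 1] parts add up to
    [r * q >= n]. A vertex of part [i] or [j] misses at most these two parts, any other vertex only
    its own, so always at most [q] vertices. *)
Lemma delta_cov_lower_barrier h (H : ograph h) n :
  0 < n -> 0 < interval_chi H -> has_local_barrier H ->
  n - (n.-1 %/ interval_chi H).+1 < delta_cov H n.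
Proof.
set r := interval_chi H => n0 r0 [i [j [ij bar]]]; set q := (_ %/ _).+1.
pose sz (l : 'I_r.+1) := if l == i then 1 else if l == j then q.-1 else q.
have ji : (j == i) = false by rewrite eq_sym (negPf ij).
have szi : sz i = 1 by rewrite /sz eqxx.
have szj : sz j = q.-1 by rewrite /sz ji eqxx.
have szs : n <= \sum_l sz l.
  apply: leq_trans (sum_leq_mul_ceil n0 r0) _.
  rewrite -/q -(leq_add2l q) -mulSn.
  have -> : r.+1 * q = \sum_(l < r.+1) q by rewrite sum_nat_const card_ord.
  rewrite (bigD1 i) //= (bigD1 j) ?ji //= leq_add2l.
  rewrite [leqRHS](bigD1 i) //= [X in _ <= _ + X](bigD1 j) ?ji //= szi szj.
  rewrite [leqRHS]addnA add1n leq_add2l leq_eqVlt.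
  apply/orP; left; apply/eqP/eq_bigr => l /andP[li lj].
  by rewrite /sz (negPf li) (negPf lj).
have [|c [mono csz [x cx]]] := @interval_partition r.+1 sz i n _ n0 szs.
  by rewrite szi.
pose M (a b : 'I_r.+1) := (a != b) && ([set a; b] != [set i; j]).
have Msym : symmetric M by move=> a b; rewrite /M eq_sym setUC.
have Mirr : irreflexive M by move=> a; rewrite /M eqxx.
have ci y : c y = i -> y = x.
  move=> cy; apply/eqP; rewrite -in_set1.
  have : [set x] \subset [set y | c y == i] by rewrite sub1set inE cx.
  move/subset_leqif_cards/geq_leqif; rewrite cards1 (leq_trans (csz i)) ?szi //.
  by move/esym/eqP->; rewrite inE cy.
apply: (@class_graph_lt_delta_cov _ _ _ _ M Msym Mirr c).
  move=> y; have [e|ne] := boolP (c y \in [set i; j]).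
    apply: (@leq_trans #|[set z | c z == i] :|: [set z | c z == j]|).
      apply: subset_leq_card; apply/subsetP => z; rewrite inE negb_and !negbK.
      move=> zy; suff : c z \in [set i; j] by rewrite !inE.
      by case/orP: zy => [/eqP<-//|/eqP<-]; rewrite set22.
    apply: leq_trans (leq_card_setU _ _) _.
    apply: leq_trans (leq_add (csz i) (csz j)) _.
    by rewrite szi szj.
  apply: (@leq_trans #|[set z | c z == c y]|).
    apply: subset_leq_card; apply/subsetP => z; rewrite inE negb_and !negbK.
    case/orP => [/eqP->|/eqP e]; first by rewrite inE.
    by move: ne; rewrite -e set21.
  apply: leq_trans (csz _) _; rewrite /sz; move: ne; rewrite !inE negb_or.
  by case/andP=> /negPf-> /negPf->.
(* A copy through [x] induces an interval colouring with class [i] equal to the singleton of [v];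
   the barrier then forces an edge between parts [i] and [j]. *)
move=> /(_ x)[phi [copy [v phiv]]].
have [//|w] := bar _ (copy_class_graph mono copy) v.
  apply/setP => u; rewrite !inE; apply/eqP/eqP => [/ci|->]; last by rewrite phiv.
  by rewrite -phiv => /(let: And3 inj _ _ := copy in inj).
case: copy => _ _ phi_adj; rewrite inE => /eqP wj /phi_adj /=.
by rewrite phiv cx wj /M eqxx andbF.
Qed.

(** * Upper bounds under a discrete degree condition *)

Lemma has_cover_no_barrier h (H : ograph h) p :
  0 < p -> 1 < interval_chi H -> ~ has_local_barrier H ->
  exists n0, forall n (G : ograph n), n0 <= n ->
    (forall v, (interval_chi H).-1 * nonadj G setT v * p <= p.-1 * n) ->
    has_cover H G.
Proof.
set r := interval_chi H => p0 r1 nobar; have h0 := interval_chi_ord0 (ltnW r1).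
have [m rE] : exists m, r = m.+2 by exists r.-2; lia.
have t0 : 0 < (2 * (r * h)).+1 by [].
have [T [u0 ext]] := blowup_extend m.+1 p0 t0.
have [n0 bl] := @blowup_in_nbhd m p T.+1 p0 isT.
exists (maxn u0 n0) => n G; rewrite geq_max => /andP[u0n n0n] nd x.
have {}nd v : m.+1 * nonadj G setT v * p <= p.-1 * n by have := nd v; rewrite rE.
have [A [[cA compA] Ax]] := bl n G x n0n nd.
pose A' i := subset_of_size T (A i).
have A'A i : A' i \subset A i by apply: subset_of_size_sub.
have [|v||B [blB BA _]] := ext n G setT A'.
- by rewrite cardsT card_ord.
- by rewrite cardsT card_ord.
- split=> [i im|i j im jm ij a b /(subsetP (A'A i)) aA /(subsetP (A'A j)) bA].
    by rewrite card_subset_of_size // cA.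
  exact: (compA i j).
(* The part of index [m.+1 = r - 1] came from the whole vertex set and is the exceptional one; the
   others lie in the neighbourhood of [x]. *)
apply: (@cover_vertex _ H _ G x r m.+1 B) => //; first exact: ltnW.
- by rewrite {1}rE.
- move=> i; rewrite rE ltnS leq_eqVlt => /orP[/eqP->|im _]; first by rewrite eqxx.
  exact: subset_trans (BA i im) (subset_trans (A'A i) (Ax i im)).
move=> i j ij; apply/not_existsP => no; apply: nobar.
exists i, j; split=> // V colV v Vi.
apply: contrapT => now; case: (no V); exists v; split=> // _ w wj.
by apply/negP => vw; apply: now; exists w.
Qed.

(** All [r] parts fit inside the neighbourhood of [x], so the colourings from [split_colouring]
    suffice, barrier or not. *)
Lemma has_cover_large_degree h (H : ograph h) p :
  0 < p -> 1 < interval_chi H ->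
  exists n0, forall n (G : ograph n), n0 <= n ->
    (forall v, interval_chi H * nonadj G setT v * p <= p.-1 * n) ->
    has_cover H G.
Proof.
set r := interval_chi H => p0 r1; have h0 := interval_chi_ord0 (ltnW r1).
have [n0 bl] := @blowup_in_nbhd r.-1 p (2 * (r * h)).+1 p0 isT.
exists n0 => n G n0n nd x; have r0 := ltnW r1; rewrite (prednK r0) in bl.
have [A [blA Ax]] := bl n G x n0n nd.
apply: (@cover_vertex _ H _ G x r r A) => // [i ir _|i j _]; first exact: Ax.
have [V colV] := interval_chi_colouring H.
have [V' [v [colV' V'i]]] := split_colouring h0 colV i.
by exists V', v; split=> //; rewrite ltnn.
Qed.

(** * Passage to real bounds *)

Local Open Scope ring_scope.

(** Nonnegativity makes [Num.truncn] of the bound its floor. *)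
Lemma cover_bound_ge0 (R : realType) m n (eta : R) : (0 < m)%N -> 0 < eta ->
  0 <= (1 - 1 / m%:R + eta) * n%:R.
Proof.
move=> m0 eta0; rewrite mulr_ge0 // addr_ge0 ?(ltW eta0) // subr_ge0 mul1r.
by rewrite invf_le1 ?ltr0n // ler1n.
Qed.

Lemma nonadj_of_min_degree (R : realType) m (eta : R) : (0 < m)%N -> 0 < eta ->
  exists p n0, (0 < p)%N /\ forall n (G : ograph n), (n0 <= n)%N ->
    (Num.truncn ((1 - 1 / m%:R + eta) * n%:R) <= min_degree G)%N ->
    forall v, (m * nonadj G setT v * p <= p.-1 * n)%N.
Proof.
(* This [p] gives [p * m * eta >= 2], hence a gain of [2 * n]: one [n] yields the factor [p - 1],
   the other absorbs the rounding error [p * m], at most [n] by the choice of [n0]. *)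
move=> m0 eta0; pose p := (Num.bound (2 / (m%:R * eta))).+1.
exists p, (p * m)%N; split=> // n G n0n degG v.
have m0R : 0 < m%:R :> R by rewrite ltr0n.
have pm : 2 <= p%:R * m%:R * eta.
  have : 2 / (m%:R * eta) < p%:R.
    apply: lt_trans (archi_boundP _) _; last by rewrite ltr_nat.
    by rewrite divr_ge0 // ltW // mulr_gt0.
  by rewrite ltr_pdivrMr ?mulr_gt0 // mulrA => /ltW.
have {}n0n : p%:R * m%:R <= n%:R :> R by rewrite -natrM ler_nat.
have degv := leq_trans degG (min_degree_le G v).
have := degree_nonadj G v; move: (degree G v) (nonadj G setT v) degv => d b degv db.
have /(congr1 (fun k => k%:R : R)) := db; rewrite natrD => dbR.
have dR : (1 - 1 / m%:R + eta) * n%:R < d%:R + 1.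
  by rewrite natr1 -truncn_lt_nat ?ltnS // cover_bound_ge0.
have {}dR : m%:R * b%:R < n%:R - m%:R * eta * n%:R + m%:R.
  have : m%:R * ((1 - 1 / m%:R + eta) * n%:R) < m%:R * (d%:R + 1).
    by rewrite ltr_pM2l.
  have -> : m%:R * ((1 - 1 / m%:R + eta) * n%:R)
            = m%:R * n%:R - n%:R + m%:R * eta * n%:R.
    by field; rewrite lt0r_neq0.
  by rewrite -dbR; lra.
rewrite -(ler_nat R) !natrM.
have -> : p.-1%:R = p%:R - 1 :> R by rewrite -[in RHS](@prednK p) // -natr1 addrK.
have pR : 0 < p%:R :> R by rewrite ltr0n.
have : p%:R * (m%:R * b%:R) <= p%:R * (n%:R - m%:R * eta * n%:R + m%:R).
  by rewrite ler_pM2l // ltW.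
have : 2 * n%:R <= p%:R * m%:R * eta * n%:R by rewrite ler_wpM2r.
lra.
Qed.

(** The inequality is strict because the ceiling of [n / m], minus one, is less than [n / m]. *)
Lemma lt_real_of_ceil (R : realType) m n d : (0 < m)%N -> (0 < n)%N ->
  (n - (n.-1 %/ m).+1 < d)%N -> (1 - 1 / m%:R) * n%:R < d%:R :> R.
Proof.
move=> m0 n0; set q := (_ %/ _)%N => nd.
have m0R : 0 < m%:R :> R by rewrite ltr0n.
have qm : (q * m < n)%N by have := leq_divM n.-1 m; lia.
have : n%:R <= d%:R + q%:R :> R by rewrite -natrD ler_nat; lia.
have : q%:R < n%:R / m%:R :> R by rewrite ltr_pdivlMr // -natrM ltr_nat.
by rewrite mulrBl mul1r mul1r [_^-1 * _]mulrC; lra.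
Qed.

Lemma delta_cov_upper (R : realType) h (H : ograph h) m (eta : R) :
  (0 < m)%N -> 0 < eta ->
  (forall p, (0 < p)%N -> exists n0, forall n (G : ograph n), (n0 <= n)%N ->
     (forall v, m * nonadj G setT v * p <= p.-1 * n)%N -> has_cover H G) ->
  exists n0, forall n, (n0 <= n)%N ->
    (delta_cov H n)%:R <= (1 - 1 / m%:R + eta) * n%:R.
Proof.
move=> m0 eta0 cov; have [p [n1 [p0 nd]]] := nonadj_of_min_degree m0 eta0.
have [n2 {}cov] := cov p p0; exists (maxn n1 n2) => n.
rewrite geq_max => /andP[n1n n2n].
apply: (@le_trans _ _ (Num.truncn ((1 - 1 / m%:R + eta) * n%:R))%:R).
  rewrite ler_nat; apply: delta_cov_le => G degG; apply: cov => //.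
  exact: nd.
by rewrite truncn_le cover_bound_ge0.
Qed.

Theorem theorem1p10 (R : realType) (h : nat) (H : ograph h) (eta : R)
    (chi_ge2 : (2 <= interval_chi H)%N) (eta_gt0 : 0 < eta) :
  exists n0 : nat, forall n : nat, (n0 <= n)%N ->
    (~ has_local_barrier H ->
       (1 - 1 / ((interval_chi H)%:R - 1)) * n%:R < (delta_cov H n)%:R :> R
       /\ (delta_cov H n)%:R
            <= (1 - 1 / ((interval_chi H)%:R - 1) + eta) * n%:R)
    /\
    (has_local_barrier H ->
       (1 - 1 / (interval_chi H)%:R) * n%:R < (delta_cov H n)%:R :> R
       /\ (delta_cov H n)%:R
            <= (1 - 1 / (interval_chi H)%:R + eta) * n%:R).
Proof.
set r := interval_chi H.
have r0 : (0 < r)%N := ltnW chi_ge2.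
have r10 : (0 < r.-1)%N by rewrite -ltnS prednK.
have -> : r%:R - 1 = r.-1%:R :> R by rewrite -[in LHS](prednK r0) -natr1 addrK.
have [nB upB] := delta_cov_upper r0 eta_gt0
  (fun p p0 => has_cover_large_degree p0 chi_ge2).
(* The threshold must be fixed before it is known which case applies, so the case is decided
   classically; with a barrier the claim is vacuous. *)
have [nN upN] : exists n0, forall n, (n0 <= n)%N -> ~ has_local_barrier H ->
    (delta_cov H n)%:R <= (1 - 1 / r.-1%:R + eta) * n%:R.
  have [bar|nobar] := pselect (has_local_barrier H); first by exists 0.
  have [n0 up] := delta_cov_upper r10 eta_gt0
    (fun p p0 => has_cover_no_barrier p0 chi_ge2 nobar).
  by exists n0 => n n0n _; apply: up.
(* The strict lower bounds need [n > 0]. *)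
exists (maxn 1 (maxn nB nN)) => n; rewrite !geq_max => /and3P[n0 nBn nNn].
split=> bar; split; [| exact: upN | | exact: upB]; apply: lt_real_of_ceil => //.
  by apply: delta_cov_lower => //; rewrite ltn_predL.
exact: delta_cov_lower_barrier.
Qed.
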